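(* Let $X_{L,Q,M_0\times\mathbb{R}}$ be a time-independent nonholonomic system with affine constraints (regular time-independent Lagrangian $L:TQ\to\mathbb{R}$, regarded also as a function on $TQ\times\mathbb{R}$ constant in $t$; constraint submanifold an affine subbundle $M_0\subset TQ$), and let $\mathcal{C}:U\times\mathbb{R}\to Q\times\mathbb{R}$ be a time-dependent diffeomorphism from a manifold $U$ onto $Q$. Let $D\mathcal{C}:TU\times\mathbb{R}\to TQ\times\mathbb{R}$ be its lift and $E^*_{L,\mathcal{C}}=E_{L\circ D\mathcal{C}}\circ D\mathcal{C}^{-1}$. Assume that: (i) the function $L\circ D\mathcal{C}:TU\times\mathbb{R}\to\mathbb{R}$ is independent of $t$; (ii) the function $E^*_{L,\mathcal{C}}:TQ\times\mathbb{R}\to\mathbb{R}$ is independent of $t$; (iii) $D\mathcal{C}^{-1}(M_0\times\mathbb{R})$ is a time-independent extended linear subbundle of $TU$, that is, $D\mathcal{C}^{-1}(M_0\times\mathbb{R})=\tilde M_0\times\mathbb{R}$ for some linear subbundle $\tilde M_0$ of $TU$. Then the moving energy $E^*_{L,\mathcal{C},M_0\times\mathbb{R}}:=E^*_{L,\mathcal{C}}|_{M_0\times\mathbb{R}}$ is a time-independent first integral of $X_{L,Q,M_0\times\mathbb{R}}$.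
   Context: All manifolds and maps are smooth and all vector fields are assumed complete. Time-independent nonholonomic system with affine constraints. $Q$ is an $n$-dimensional manifold and $L:TQ\to\mathbb{R}$ is a regular Lagrangian, i.e. in all bundle coordinates $(q,\dot q)$ the matrix $\frac{\partial^2L}{\partial\dot q\,\partial\dot q}$ is everywhere invertible. $\mathcal{D}_0$ is a nonintegrable distribution on $Q$ of constant rank $r$, $1<r<n$, and $\xi_0$ is a vector field on $Q$. They define the affine distribution $\mathcal{M}_0=\xi_0+\mathcal{D}_0$ with fibers $(\mathcal{M}_0)_q=\{v_q\in T_qQ: v_q-\xi_0(q)\in(\mathcal{D}_0)_q\}$; $\mathcal{D}_0$ is determined by $\mathcal{M}_0$ and $\xi_0$ is determined up to a section of $\mathcal{D}_0$. The constraint submanifold is the affine subbundle $M_0=\{v_q : q\in Q,\ v_q\in(\mathcal{M}_0)_q\}$ of $TQ$. The constraint is ideal (d'Alembert): reaction forces at $q$ lie in the annihilator $(\mathcal{D}_0)_q^\circ\subset T_q^*Q$. There is a unique function $R_{L,M_0}:M_0\to\mathcal{D}_0^\circ$ (over the identity of $Q$) such that the restriction to $M_0$ of the Lagrange equations with reaction force, $\frac{d}{dt}\frac{\partial L}{\partial\dot q}-\frac{\partial L}{\partial q}=R_{L,M_0}$, defines a vector field on $M_0$; this vector field is $X_{L,Q,M_0}$ (existence and uniqueness of $R_{L,M_0}$ are taken as part of the setting). $X_{L,Q,M_0\times\mathbb{R}}$ denotes the vector field $X_{L,Q,M_0}+\partial_t$ on $M_0\times\mathbb{R}$, and is identified with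 $X_{L,Q,M_0}$. Time-dependent diffeomorphism. A time-dependent diffeomorphism of $U$ onto $Q$ is a diffeomorphism $\mathcal{C}:U\times\mathbb{R}\to Q\times\mathbb{R}$ of the form $\mathcal{C}(u,t)=(\mathcal{Q}(u,t),t)$; thus each $\mathcal{Q}_t:=\mathcal{Q}(\cdot,t):U\to Q$ is a diffeomorphism. Its lift is the diffeomorphism $D\mathcal{C}:TU\times\mathbb{R}\to TQ\times\mathbb{R}$, $D\mathcal{C}(v_u,t)=\big(T_u\mathcal{Q}_t\cdot v_u+\frac{\partial\mathcal{Q}}{\partial t}(u,t),\,t\big)$, where $\frac{\partial\mathcal{Q}}{\partial t}(u,t)\in T_{\mathcal{Q}_t(u)}Q$. Energy. For a Lagrangian $L$ on $TQ\times\mathbb{R}$ (and likewise on $TU\times\mathbb{R}$), the energy is $E_L(v_q,t)=\langle p(v_q,t),v_q\rangle-L(v_q,t)$, with $p$ the momentum covector; in coordinates $E_L=\dot q\cdot\frac{\partial L}{\partial\dot q}-L$. *)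

(* Defs.v *)
(* MathComp-Analysis. *)
From mathcomp Require Import all_boot all_order all_algebra.
From mathcomp Require Import all_classical all_reals all_analysis.
Set Implicit Arguments.
Unset Strict Implicit.
Unset Printing Implicit Defensive.
Import Order.TTheory GRing.Theory Num.Theory.
Import numFieldNormedType.Exports.
Local Open Scope classical_set_scope.
Local Open Scope ring_scope.

(* f is of class C^k on the open set O: k times Frechet differentiable with
   continuous k-th derivative.  In finite dimension the derivative
   x |-> 'd f x is C^k iff all its evaluations x |-> 'd f x v are. *)
Fixpoint Ck (R : realType) (V W : normedModType R) (k : nat)
    (O : set V) (f : V -> W) : Prop :=
  match k with
  | 0 => forall x, O x -> {for x, continuous f}
  | k'.+1 => (forall x, O x -> differentiable f x)
             /\ forall v, Ck k' O (fun x => 'd f x v)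
  end.

Definition smooth_on (R : realType) (V W : normedModType R)
    (O : set V) (f : V -> W) : Prop :=
  forall k, Ck k O f.

(* A set with n-dimensional charts, with no axiom yet: see is_manifold.
   As [ccoord c] is total, its values outside [cdom c] are meaningless.
   [chart_at q] is a preferred chart around q; it only serves to represent
   tangent vectors (see tcomp), and the notions below are independent of it. *)
Record atlas (R : realType) (n : nat) := Atlas {
  carrier :> Type;
  chart : Type;
  cdom : chart -> set carrier;
  ccoord : chart -> carrier -> 'rV[R]_n;
  chart_at : carrier -> chart
}.
Arguments chart {R n} _.
Arguments cdom {R n} _ _ _.
Arguments ccoord {R n} _ _ _.
Arguments chart_at {R n} _ _.

(* The local representative f \o (ccoord c)^-1 of f, on [ccoord c @` cdom c]. *)
Definition rep (R : realType) (n : nat) (M : atlas R n) (W : normedModType R)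
    (c : chart M) (f : M -> W) (x : 'rV[R]_n) : W :=
  get (f @` (cdom M c `&` ccoord M c @^-1` [set x])).

(* The manifold topology, i.e. the one making all the charts homeomorphisms. *)
Definition mopen (R : realType) (n : nat) (M : atlas R n) (O : set M) : Prop :=
  forall c, open (ccoord M c @` (cdom M c `&` O)).

Definition is_manifold (R : realType) (n : nat) (M : atlas R n) : Prop :=
  [/\ forall q, cdom M (chart_at M q) q,
      forall c q q', cdom M c q -> cdom M c q' ->
        ccoord M c q = ccoord M c q' -> q = q',
      forall c d, open (ccoord M c @` (cdom M c `&` cdom M d))
        /\ smooth_on (ccoord M c @` (cdom M c `&` cdom M d))
                     (rep c (ccoord M d)),
      forall q q' : M, q <> q' -> exists O O' : set M,
        [/\ mopen O, mopen O', O q, O' q' & O `&` O' = set0]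
    & exists B : nat -> set M, (forall i, mopen (B i)) /\
        forall (O : set M) q, mopen O -> O q ->
          exists i, B i q /\ B i `<=` O].

(* The openness condition says that F is continuous on the open set O. *)
Definition smooth_map (R : realType) (m n : nat) (M : atlas R m)
    (N : atlas R n) (O : set M) (F : M -> N) : Prop :=
  forall c d,
    let A := ccoord M c @` (cdom M c `&` O `&` F @^-1` cdom N d) in
    open A /\ smooth_on A (rep c (ccoord N d \o F)).

Definition smooth_fun (R : realType) (n : nat) (M : atlas R n)
    (f : M -> R) : Prop :=
  forall c, smooth_on (ccoord M c @` cdom M c) (rep c f).

(* Smoothness of a map defined on an arbitrary subset A. *)
Definition smooth_along (R : realType) (m n : nat) (M : atlas R m)
    (N : atlas R n) (A : set M) (F : M -> N) : Prop :=
  forall x, A x -> exists (O : set M) (G : M -> N),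
    [/\ mopen O, O x, smooth_map O G & forall y, O y -> A y -> G y = F y].

Definition euclid (R : realType) (n : nat) : atlas R n :=
  @Atlas R n 'rV[R]_n unit (fun=> setT) (fun _ x => x) (fun=> tt).

Definition line (R : realType) : atlas R 1 :=
  @Atlas R 1 R unit (fun=> setT) (fun _ t => t%:M) (fun=> tt).

Definition prod_atlas (R : realType) (m n : nat) (M : atlas R m)
    (N : atlas R n) : atlas R (m + n) :=
  @Atlas R (m + n) (M * N)%type (chart M * chart N)%type
    (fun c x => cdom M c.1 x.1 /\ cdom N c.2 x.2)
    (fun c x => row_mx (ccoord M c.1 x.1) (ccoord N c.2 x.2))
    (fun x => (chart_at M x.1, chart_at N x.2)).

Definition times_line (R : realType) (n : nat) (M : atlas R n) :
    atlas R (n + 1) :=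
  prod_atlas M (line R).

(* The tangent space at q is a copy of R^n: the tangent vector represented by
   v : 'rV[R]_n is the one with components v in the chart [chart_at M q].
   Hence its components in another chart c are given by the Jacobian of the
   transition map. *)
Definition tcomp (R : realType) (n : nat) (M : atlas R n) (c : chart M)
    (q : M) (v : 'rV[R]_n) : 'rV[R]_n :=
  'D_v (rep (chart_at M q) (ccoord M c)) (ccoord M (chart_at M q) q).

(* The tangent bundle: (q, v) is the vector v of the tangent space at q, and
   its bundle coordinates are (coordinates of q, components of v). *)
Definition TB (R : realType) (n : nat) (M : atlas R n) : atlas R (n + n) :=
  @Atlas R (n + n) (M * 'rV[R]_n)%type (chart M)
    (fun c x => cdom M c x.1)
    (fun c x => row_mx (ccoord M c x.1) (tcomp c x.1 x.2))
    (fun x => chart_at M x.1).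

Definition tmap (R : realType) (m n : nat) (M : atlas R m) (N : atlas R n)
    (F : M -> N) (q : M) (v : 'rV[R]_m) : 'rV[R]_n :=
  'D_v (rep (chart_at M q) (ccoord N (chart_at N (F q)) \o F))
    (ccoord M (chart_at M q) q).

Definition velocity (R : realType) (n : nat) (M : atlas R n)
    (g : R -> M) (t : R) : 'rV[R]_n :=
  derive1 (ccoord M (chart_at M (g t)) \o g : R -> 'rV[R]_n) t.

Definition section (R : realType) (n : nat) (M : atlas R n)
    (X : M -> 'rV[R]_n) : M -> TB M :=
  fun q => (q, X q).

Definition smooth_vector_field (R : realType) (n : nat) (M : atlas R n)
    (X : M -> 'rV[R]_n) : Prop :=
  smooth_map (N := TB M) setT (section X).

(* The curve is only considered on the open set J. *)
Definition smooth_curve (R : realType) (n : nat) (M : atlas R n)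
    (J : set R) (g : R -> M) : Prop :=
  smooth_map (M := line R) (N := M) J g.

(* w, a vector at p, is the velocity of a curve lying in A: for a submanifold A
   this says that w belongs to the tangent space of A at p. *)
Definition tangent_to (R : realType) (n : nat) (M : atlas R n)
    (A : set M) (p : M) (w : 'rV[R]_n) : Prop :=
  exists (J : set R) (g : R -> M),
    [/\ open J /\ J 0, smooth_curve J g, forall t, J t -> A (g t),
        g 0 = p & velocity g 0 = w].

Definition integral_curve (R : realType) (n : nat) (M : atlas R n)
    (A : set M) (X : M -> 'rV[R]_n) (J : set R) (g : R -> M) : Prop :=
  smooth_curve J g /\ forall t, J t -> A (g t) /\ velocity g t = X (g t).

Definition complete_vector_field (R : realType) (n : nat) (M : atlas R n)
    (A : set M) (X : M -> 'rV[R]_n) : Prop :=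
  forall p, A p -> exists g : R -> M,
    integral_curve A X setT g /\ g 0 = p.

(* X and F are only considered on the submanifold A. *)
Definition first_integral (R : realType) (n : nat) (M : atlas R n)
    (A : set M) (X : M -> 'rV[R]_n) (F : M -> R) : Prop :=
  forall (J : set R) (g : R -> M), open J -> is_interval J ->
    integral_curve A X J g ->
    forall s t, J s -> J t -> F (g s) = F (g t).

(* Smooth distribution of constant rank k, with fibers D q: locally spanned by
   k smooth, pointwise linearly independent vector fields (the rows of B). *)
Definition is_distribution (R : realType) (n : nat) (M : atlas R n) (k : nat)
    (D : M -> set 'rV[R]_n) : Prop :=
  forall q, exists (O : set M) (B : M -> 'M[R]_(k, n)),
    [/\ mopen O, O q,
        forall i, smooth_map (N := TB M) O (section (fun x => row i (B x)))
      & forall x, O x -> row_free (B x) /\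
          D x = [set v : 'rV[R]_n | (v <= B x)%MS]].

Definition total_space (R : realType) (n : nat) (M : atlas R n)
    (D : M -> set 'rV[R]_n) : set (TB M) :=
  [set x | D x.1 x.2].

Definition is_linear_subbundle (R : realType) (n : nat) (M : atlas R n)
    (A : set (TB M)) : Prop :=
  exists (k : nat) (D : M -> set 'rV[R]_n),
    is_distribution k D /\ A = total_space D.

(* Every point lies on an integral manifold, parametrized locally by an open
   set W of R^k; as D has rank k, such a parametrization f is an immersion. *)
Definition integrable_distribution (R : realType) (n : nat) (M : atlas R n)
    (k : nat) (D : M -> set 'rV[R]_n) : Prop :=
  forall q, exists (W : set (euclid R k)) (f : euclid R k -> M),
    [/\ mopen W, W 0, smooth_map W f, f 0 = q
      & forall x, W x -> D (f x) = range (tmap f x)].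

Definition affine_subbundle (R : realType) (n : nat) (M : atlas R n)
    (xi : M -> 'rV[R]_n) (D : M -> set 'rV[R]_n) : set (TB M) :=
  [set x | D x.1 (x.2 - xi x.1)].

(* Directions dq and d(qdot) in the bundle coordinates (q, qdot). *)
Definition hor (R : realType) (n : nat) (w : 'rV[R]_n) : 'rV[R]_(n + n) :=
  row_mx w 0.
Definition ver (R : realType) (n : nat) (w : 'rV[R]_n) : 'rV[R]_(n + n) :=
  row_mx 0 w.

Definition regular_lagrangian (R : realType) (n : nat) (M : atlas R n)
    (L : TB M -> R) : Prop :=
  forall (c : chart M) (x : TB M), cdom (TB M) c x ->
    (\matrix_(i < n, j < n)
       'D_(ver (delta_mx 0 i)) ('D_(ver (delta_mx 0 j)) (rep (M := TB M) c L))
         (ccoord (TB M) c x)) \in unitmx.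

(* Lagrange's equations d/dt (dL/dqdot) - dL/dq = f at x = (q, v), for the
   vector Z tangent to TM at x and the covector f at q.  In every chart Z has
   components (v, vdot), d/dt is the derivative along Z, and the covectors are
   compared on every tangent vector w at q. *)
Definition lagrange_at (R : realType) (n : nat) (M : atlas R n)
    (L : TB M -> R) (x : TB M) (Z : 'rV[R]_(n + n))
    (f : {scalar 'rV[R]_n}) : Prop :=
  forall c : chart M, cdom (TB M) c x ->
    let Lc := rep (M := TB M) c L in
    let y := ccoord (TB M) c x in
    let Zc := tcomp (M := TB M) c x Z in
    lsubmx Zc = tcomp c x.1 x.2 /\
    forall w : 'rV[R]_n, let wc := tcomp c x.1 w in
      'D_Zc ('D_(ver wc) Lc) y - 'D_(hor wc) Lc y = f w.

(* Z is the vector field on M0 given by the restriction to M0 of Lagrange's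
   equations with the reaction force rho, which takes values in the annihilator
   of D.  The values of Z and rho outside M0 are
   irrelevant. *)
Definition nonholonomic_field (R : realType) (n : nat) (M : atlas R n)
    (L : TB M -> R) (M0 : set (TB M)) (D : M -> set 'rV[R]_n)
    (rho : TB M -> {scalar 'rV[R]_n}) (Z : TB M -> 'rV[R]_(n + n)) : Prop :=
  smooth_along (N := TB (TB M)) M0 (section Z) /\
  forall x, M0 x ->
    [/\ tangent_to M0 x (Z x),
        forall w, D x.1 w -> rho x w = 0
      & lagrange_at L x (Z x) (rho x)].

(* Z + d/dt on M x R. *)
Definition add_dt (R : realType) (n : nat) (M : atlas R n)
    (Z : M -> 'rV[R]_n) : times_line M -> 'rV[R]_(n + 1) :=
  fun x => row_mx (Z x.1) 1%:M.

Definition time_dependent_map (R : realType) (m n : nat) (U : atlas R m)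
    (Q : atlas R n) (Qt : U -> R -> Q) : times_line U -> times_line Q :=
  fun x => (Qt x.1 x.2, x.2).

Definition diffeomorphism (R : realType) (m n : nat) (M : atlas R m)
    (N : atlas R n) (F : M -> N) : Prop :=
  exists G : N -> M, [/\ cancel F G, cancel G F,
    smooth_map setT F & smooth_map setT G].

Definition lift_tdep (R : realType) (m n : nat) (U : atlas R m)
    (Q : atlas R n) (Qt : U -> R -> Q) :
    times_line (TB U) -> times_line (TB Q) :=
  fun x => let: ((u, v), t) := x in
    ((Qt u t, tmap (Qt^~ t) u v + velocity (Qt u) t), t).

(* <p(v, t), v> - L(v, t), where the momentum p(v, t) is the derivative of L
   along the fiber. *)
Definition energy (R : realType) (n : nat) (M : atlas R n)
    (L : times_line (TB M) -> R) : times_line (TB M) -> R :=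
  fun x => let: ((q, v), t) := x in
    'D_v (fun w : 'rV[R]_n => L ((q, w), t)) v - L ((q, v), t).

Definition autonomous (R : realType) (n : nat) (M : atlas R n) (L : M -> R) :
    times_line M -> R :=
  fun x => L x.1.

(* E_{L o DC} o DC^-1; since DC is a bijection, the set below is a singleton. *)
Definition moving_energy (R : realType) (m n : nat) (U : atlas R m)
    (Q : atlas R n) (Qt : U -> R -> Q) (L : TB Q -> R) :
    times_line (TB Q) -> R :=
  fun y => get (energy (autonomous L \o lift_tdep Qt)
                  @` (lift_tdep Qt @^-1` [set y])).

Definition time_independent (R : realType) (n : nat) (M : atlas R n)
    (A : set M) (F : times_line M -> R) : Prop :=
  forall x s t, A x -> F (x, s) = F (x, t).

Definition time_extended (R : realType) (n : nat) (M : atlas R n) (A : set M) :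
    set (times_line M) :=
  [set x | A x.1].

(* Main.v *)
(* Let g = (q, v, t) be an integral curve in M0 x R and u(s) the preimage of q(s)
   under Q_t(s).  Write P(x, t) for the coordinates of Q_t(x) and
   xi = dP/dt along the curve.  As v = T Q_t(u') + xi, the moving energy
   along g is <p, v - xi> - L, with p the momentum of L.  By Lagrange's
   equations its derivative is <R, v - xi> - (<dL/dq, xi> + <p, xi'>).
   The bracket is the derivative in t, with u and u' frozen, of
   L(DC((u, u'), t)): this uses the symmetry of the second derivatives of P,
   and it vanishes by (i).  By (iii) the image xi of the zero vector belongs
   to M0, as does v, so v - xi is in D0 and the ideal reaction force R
   annihilates it. *)
Require Import Defs.
From mathcomp Require Import all_boot all_order all_algebra.
From mathcomp Require Import all_classical all_reals all_analysis.
Import Order.TTheory GRing.Theory Num.Theory.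
Import numFieldNormedType.Exports.
Local Open Scope classical_set_scope.
Local Open Scope ring_scope.
Set Implicit Arguments.
Unset Strict Implicit.
Unset Printing Implicit Defensive.

(** * Directional derivatives and C^k maps *)

(** Reduces directional derivatives to functions of one real variable, for which having a derivative
    and being differentiable coincide. *)
Lemma is_derive_lineP (R : realType) (V W : normedModType R) (f : V -> W)
    (x v : V) (l : W) :
  is_derive x v f l <-> is_derive (0 : R) 1 (fun h : R => f (h *: v + x)) l.
Proof.
have E : 'D_v f x = 'D_1 (fun h : R => f (h *: v + x)) 0.
  rewrite /derive; set a := (a in a @ _); set b := (b in _ = lim (b @ _)).
  suff -> : a = b by [].
  by apply/funext => h; rewrite /a /b /= scale0r add0r addr0 [_%:A]mulr1.
split=> -[d <-].
  exact: DeriveDef ((derivable1P f x v).1 d) (esym E).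
exact: DeriveDef ((derivable1P f x v).2 d) E.
Qed.

Lemma is_derive_diff (R : realType) (V W : normedModType R) (f : V -> W)
    (x v : V) : differentiable f x -> is_derive x v f ('d f x v).
Proof.
by move=> df; apply: DeriveDef; [exact: diff_derivable|exact: deriveE].
Qed.

Lemma is_derive_unique (R : realType) (V W : normedModType R) (f : V -> W)
    (x v : V) (a b : W) : is_derive x v f a -> is_derive x v f b -> a = b.
Proof. by move=> [_ <-] [_ <-]. Qed.

(** Only [f] has to be differentiable: [g] enters through its restriction [k] to a line, a function
    of a real variable. *)
Lemma is_derive_comp_diff (R : realType) (U V W : normedModType R)
    (f : V -> W) (g : U -> V) (x v : U) (l : V) :
  differentiable f (g x) -> is_derive x v g l ->
  is_derive x v (f \o g) ('d f (g x) l).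
Proof.
move=> df /is_derive_lineP dg; apply/is_derive_lineP.
set k := fun h : R => g (h *: v + x) in dg.
have k0 : k 0 = g x by rewrite /k scale0r add0r.
have dk : differentiable k 0 by apply/derivable1_diffP; case: dg.
rewrite -k0 in df *.
have [_ <-] := dg; have dfk := differentiable_comp dk df.
apply: (DeriveDef (f := f \o k) ((derivable1_diffP _ _).2 dfk)).
by rewrite (deriveE _ dfk) (diff_comp dk df) /= (deriveE _ dk).
Qed.

Lemma is_derive_row_mx (R : realType) (V : normedModType R) (m n : nat)
    (f : V -> 'rV[R]_m) (g : V -> 'rV[R]_n) (x v : V) a b :
  is_derive x v f a -> is_derive x v g b ->
  is_derive x v (fun y => row_mx (f y) (g y)) (row_mx a b).
Proof.
move=> [df <-] [dg <-].
have fij j : (fun y => row_mx (f y) (g y) ord0 j) =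
    match fintype.split j with
    | inl j1 => (fun y => f y ord0 j1)
    | inr j2 => (fun y => g y ord0 j2)
    end.
  by apply/funext => y; rewrite mxE; case: (fintype.split j).
have d : derivable (fun y => row_mx (f y) (g y)) x v.
  apply/derivable_mxP => i j; rewrite ord1 fij.
  by case: (fintype.split j) => k;
    [exact: (derivable_mxP f x v).1|exact: (derivable_mxP g x v).1].
apply: DeriveDef => //.
rewrite derive_mx //; apply/rowP => j; rewrite !mxE fij.
by case: (fintype.split j) => k; rewrite derive_mx // mxE.
Qed.

Lemma is_derive_mx_coord (R : realType) (V : normedModType R) (m n : nat)
    (f : V -> 'M[R]_(m, n)) (x v : V) a i j :
  is_derive x v f a -> is_derive x v (fun y => f y i j) (a i j).
Proof.
move=> [df <-]; apply: DeriveDef; first exact: (derivable_mxP f x v).1.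
by rewrite derive_mx // mxE.
Qed.

Lemma diff_linear (R : realType) (V W : normedModType R)
    (f : {linear V -> W}) x v : continuous f -> 'd f x v = f v.
Proof. by move=> cf; rewrite diff_lin. Qed.

Lemma is_derive_linear (R : realType) (U V W : normedModType R)
    (f : {linear V -> W}) (g : U -> V) (x v : U) l : continuous f ->
  is_derive x v g l -> is_derive x v (fun y => f (g y)) (f l).
Proof.
move=> cf dg; rewrite -(diff_linear (g x) l cf).
by apply: is_derive_comp_diff => //; exact: linear_differentiable.
Qed.

Lemma is_derive_lsubmx (R : realType) (V : normedModType R) (m n : nat)
    (f : V -> 'rV[R]_(m + n)) (x v : V) a :
  is_derive x v f a -> is_derive x v (fun y => lsubmx (f y)) (lsubmx a).
Proof.
exact: (@is_derive_linear _ _ _ _ lsubmx _ _ _ _ (@continuous_lsubmx R 1 m n)).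
Qed.

Lemma is_derive_rsubmx (R : realType) (V : normedModType R) (m n : nat)
    (f : V -> 'rV[R]_(m + n)) (x v : V) a :
  is_derive x v f a -> is_derive x v (fun y => rsubmx (f y)) (rsubmx a).
Proof.
exact: (@is_derive_linear _ _ _ _ rsubmx _ _ _ _ (@continuous_rsubmx R 1 m n)).
Qed.

Lemma is_derive_scale (R : realType) (V : normedModType R) (v : V) (s : R) :
  is_derive s 1 (fun h : R => h *: v) v.
Proof.
apply: DeriveDef; first by apply/derivable1_diffP.
by rewrite deriveE // diff_val scale1r.
Qed.

Lemma is_derive_line (R : realType) (V : normedModType R) (x v : V) (s : R) :
  is_derive s 1 (fun h : R => h *: v + x) v.
Proof.
apply: (is_derive_eq (is_deriveD (is_derive_scale v s) (is_derive_cst x s 1))).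
exact: addr0.
Qed.

(** * Mean value theorem and symmetry of second derivatives *)

Lemma derive0_cst (R : realType) (f : R -> R) (J : set R) :
  open J -> is_interval J -> (forall x, J x -> is_derive x 1 f 0) ->
  forall s t, J s -> J t -> f s = f t.
Proof.
move=> oJ iJ df s t; wlog st : s t / s <= t => [H Js Jt|Js Jt].
  by case: (leP s t) => [/H|/ltW /H h]; [apply|apply/esym/h].
have sub x : x \in `[s, t] -> J x.
  by rewrite in_itv /=; exact: (iJ s t Js Jt).
have [x xs||c _] := @MVT_segment _ f (fun=> 0) s t st.
- by apply/df/sub; apply: subset_itvW xs.
- by apply: derivable_within_continuous => y /sub /df[].
- by rewrite mul0r => /eqP; rewrite subr_eq0 => /eqP.
Qed.

(* The mean value theorem is applied along u0, then along v0. *)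
Lemma second_difference (R : realType) (V : normedModType R)
    (g gu guv : V -> R) (x u0 v0 : V) (s : R) : 0 < s ->
  (forall a b, 0 <= a <= s -> 0 <= b <= s ->
    is_derive (a *: u0 + b *: v0 + x) u0 g (gu (a *: u0 + b *: v0 + x))) ->
  (forall a b, 0 <= a <= s -> 0 <= b <= s ->
    is_derive (a *: u0 + b *: v0 + x) v0 gu (guv (a *: u0 + b *: v0 + x))) ->
  exists2 ab, (0 <= ab.1 <= s) && (0 <= ab.2 <= s) &
    g (s *: u0 + s *: v0 + x) - g (s *: u0 + x) - g (s *: v0 + x) + g x =
      guv (ab.1 *: u0 + ab.2 *: v0 + x) * s * s.
Proof.
move=> s0 dg dgu.
have s0' : 0 <= s <= s by rewrite ltW /=.
have z0' : 0 <= (0 : R) <= s by rewrite (ltW s0) lexx.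
(* The second difference is [k s - k 0], where [k] is the increment of [g] across the side
   [s *: v0]. *)
pose k a := g (a *: u0 + s *: v0 + x) - g (a *: u0 + x).
pose dk a := gu (a *: u0 + s *: v0 + x) - gu (a *: u0 + x).
have dline (p q : V) (h : V -> R) (a l : R) :
   is_derive (a *: p + q) p h l -> is_derive a 1 (fun a => h (a *: p + q)) l.
  move=> dh.
  have /is_derive_lineP := dh => dh0.
  have : is_derive (a : R) (1 : R)
      ((fun h0 : R => h (h0 *: p + (a *: p + q))) \o (fun b => b - a)) l.
    apply/(is_derive_lineP _ a 1).
    apply: near_eq_is_derive dh0; near=> b => /=.
    by rewrite [b%:A]mulr1 addrK.
  apply: near_eq_is_derive; near=> b => /=.
  by rewrite addrA -scalerDl subrK.
have dgs a b : 0 <= a <= s -> 0 <= b <= s ->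
    is_derive a 1 (fun a => g (a *: u0 + b *: v0 + x))
      (gu (a *: u0 + b *: v0 + x)).
  move=> ha hb; have := dg a b ha hb; rewrite -addrA => /dline.
  by apply: near_eq_is_derive; near=> c; rewrite addrA.
have dks a : 0 <= a <= s -> is_derive a 1 k (dk a).
  move=> ha; apply: is_deriveB; first exact: dgs.
  have := dgs a 0 ha z0'; rewrite scale0r addr0.
  by apply: near_eq_is_derive; near=> c; rewrite addr0.
have [|x0 |a] := @MVT _ k dk 0 s s0.
- move=> a /subset_itv_oo_cc; rewrite in_itv; exact: dks.
- by apply: derivable_within_continuous => a; rewrite in_itv => /dks [].
rewrite subr0 => /subset_itv_oo_cc; rewrite in_itv /= => ha Ea.
(* At the intermediate [a], the derivative [dk a] is itself the increment [k2 s - k2 0]. *)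
pose k2 b := gu (a *: u0 + b *: v0 + x).
have dk2 b : 0 <= b <= s -> is_derive b 1 k2 (guv (a *: u0 + b *: v0 + x)).
  move=> hb; have := dgu a b ha hb; rewrite [a *: u0 + _]addrC -addrA => /dline.
  by apply: near_eq_is_derive; near=> c; rewrite /k2 addrA [a *: u0 + _]addrC.
have [|x0 |b] := @MVT _ k2 (fun b => guv (a *: u0 + b *: v0 + x)) 0 s s0.
- move=> b /subset_itv_oo_cc; rewrite in_itv; exact: dk2.
- by apply: derivable_within_continuous => b; rewrite in_itv => /dk2 [].
rewrite subr0 => /subset_itv_oo_cc; rewrite in_itv /= => hb Eb.
exists (a, b); rewrite /= ?ha ?hb // -Eb.
move: Ea; rewrite /k /dk /k2 !scale0r !add0r addr0 => <-.
by rewrite opprB addrA addrAC.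
Unshelve. all: by end_near. Qed.

(** The second difference over a small parallelogram is symmetric in [u] and [v], and by
    [second_difference] it is s^2 times a value of [fuv], and also s^2 times a value of [fvu], at
    points near [x]. Continuity at [x] concludes. *)
Lemma mixed_derivatives_eq (R : realType) (V : normedModType R) (f : V -> R)
    (O : set V) (x u v : V) (fu fv fuv fvu : V -> R) :
  open O -> O x ->
  (forall y, O y -> is_derive y u f (fu y)) ->
  (forall y, O y -> is_derive y v f (fv y)) ->
  (forall y, O y -> is_derive y v fu (fuv y)) ->
  (forall y, O y -> is_derive y u fv (fvu y)) ->
  {for x, continuous fuv} -> {for x, continuous fvu} -> fuv x = fvu x.
Proof.
move=> oO Ox dfu dfv dfuv dfvu cuv cvu.
apply/eqP; rewrite -subr_eq0 -normr_le0; apply/ler_addgt0Pl => e e0.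
rewrite addr0.
have e20 : 0 < e / 2 by rewrite divr_gt0.
have /nbhs_ballP[r /= r0 rP] : nbhs x (O `&` [set y | `|fuv x - fuv y| < e / 2]
     `&` [set y | `|fvu x - fvu y| < e / 2]).
  apply: filterI; [apply: filterI|].
  - exact: open_nbhs_nbhs.
  - by move/cvgrPdist_lt : cuv; apply.
  - by move/cvgrPdist_lt : cvu; apply.
(* With s = r / M the parallelogram of sides [s *: u] and [s *: v] at [x] lies in the ball of radius
   [r]. The summand 1 keeps [M] positive when [u] and [v] vanish. *)
pose M := `|u| + `|v| + 1.
have M0 : 0 < M by rewrite /M ltr_wpDl // addr_ge0.
pose s := r / M.
have s0 : 0 < s by rewrite divr_gt0.
have inb a b : 0 <= a <= s -> 0 <= b <= s -> ball x r (a *: u + b *: v + x).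
  move=> /andP[a0 ass] /andP[b0 bs].
  rewrite -ball_normE /= opprD addrCA subrr addr0 normrN.
  apply: le_lt_trans (ler_normD _ _) _; rewrite !normrZ !ger0_norm //.
  apply: (@le_lt_trans _ _ (s * (`|u| + `|v|))).
    by rewrite mulrDr lerD // ler_wpM2r.
  rewrite -[ltRHS](@divfK _ M) ?gt_eqF // ltr_pM2l // /M.
  by rewrite ltrDl.
have [||[a b] /= /andP[as_ bs] E1] :=
  @second_difference _ _ f fu fuv x u v s s0.
- by move=> a b ha hb; apply: dfu; have [[]] := rP _ (inb _ _ ha hb).
- by move=> a b ha hb; apply: dfuv; have [[]] := rP _ (inb _ _ ha hb).
have [||[a' b'] /= /andP[as' bs'] E2] :=
  @second_difference _ _ f fv fvu x v u s s0.
- by move=> a' b' ha hb; rewrite [X in X + x]addrC; apply: dfv;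
    have [[]] := rP _ (inb _ _ hb ha).
- by move=> a' b' ha hb; rewrite [X in X + x]addrC; apply: dfvu;
    have [[]] := rP _ (inb _ _ hb ha).
have E : fuv (a *: u + b *: v + x) = fvu (b' *: u + a' *: v + x).
  have sn0 : s != 0 by rewrite gt_eqF.
  apply: (mulIf sn0); apply: (mulIf sn0); rewrite -E1.
  rewrite [b' *: u + _]addrC -E2.
  by rewrite [s *: v + s *: u]addrC; congr (_ + _); rewrite addrAC.
have [[_ /= h1] _] := rP _ (inb _ _ as_ bs).
have [_ /= h2] := rP _ (inb _ _ bs' as').
rewrite (splitr e) -(subrKA (fuv (a *: u + b *: v + x))).
apply: le_trans (ler_normD _ _) _; rewrite lerD // ltW // {1}E.
by rewrite distrC.
Qed.

(** * Locality of the differential and of the class C^k *)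

(** The difference [g - f] vanishes near [x], so it is a little-o, and the first-order expansion of
    [f] is also one of [g]; the differential is determined by such an expansion. *)
Lemma near_eq_diff (R : realType) (V W : normedModType R) (f g : V -> W)
    (x : V) : (\near x, f x = g x) -> differentiable f x ->
  differentiable g x /\ 'd g x = 'd f x :> (V -> W).
Proof.
move=> fg df; have cdf := diff_continuous df.
have E : g \o shift x = cst (g x) + 'd f x +o_ 0 id.
  have k0 : (g - f) \o shift x =o_ 0 (id : V -> V).
    apply/eqoP => _/posnumP[e]; near=> h.
    rewrite /= -[(g - f) (h + x)]/(g (h + x) - f (h + x)).
    have -> : f (h + x) = g (h + x).
      near: h; have := fg; rewrite [X in X -> _](near_shift 0 x).
      by apply: filterS => h /=; rewrite subr0.
    by rewrite subrr normr0 mulr_ge0.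
  have E1 : g \o shift x = (f \o shift x) + ((g - f) \o shift x).
    apply/funext => h.
    by rewrite -[RHS]/(f (h + x) + (g (h + x) - f (h + x))) addrC subrK.
  rewrite k0 in E1; rewrite -(nbhs_singleton fg).
  exact: eqaddo_trans E1 (diff_locally df).
have H := diff_unique cdf E.
by split=> //; apply/diff_locallyP; rewrite H.
Unshelve. all: by end_near. Qed.

Lemma near_eq_open (T : topologicalType) (W : Type) (f g : T -> W) (O : set T)
  (x : T) : open O -> O x -> (forall y, O y -> f y = g y) ->
  \near x, f x = g x.
Proof. by move=> oO Ox fg; apply: filterS (open_nbhs_nbhs (conj oO Ox)). Qed.

(** As [O] is open, equality on [O] is equality near each of its points, so it passes to the
    differentials and the induction goes through. *)
Lemma Ck_eq (R : realType) (V W : normedModType R) k (O : set V)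
    (f g : V -> W) : open O -> (forall x, O x -> f x = g x) ->
  Ck k O f -> Ck k O g.
Proof.
move=> oO; elim: k f g => [|k IH] f g fg /=.
  move=> cf x Ox; have nfg := near_eq_open oO Ox fg.
  rewrite /prop_for /continuous_at -(fg _ Ox).
  by apply: cvg_trans (cf x Ox); exact: near_eq_cvg.
move=> [df d2f].
have D x (Ox : O x) := near_eq_diff (near_eq_open oO Ox fg) (df x Ox).
split=> [x /D[]//|v]; apply: IH (d2f v) => x Ox.
by rewrite (D x Ox).2.
Qed.

Lemma Ck_linear (R : realType) (U V W : normedModType R) k (O : set U)
    (l : {linear V -> W}) (f : U -> V) : open O -> continuous l ->
  Ck k O f -> Ck k O (l \o f).
Proof.
move=> oO cl; elim: k f => [|k IH] f /=.
  by move=> cf x Ox; apply: continuous_comp; [exact: cf|exact: cl].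
move=> [df d2f]; have dl y : differentiable l y by exact: linear_differentiable.
split=> [x Ox|v]; first by apply: differentiable_comp => //; exact: df.
apply: (Ck_eq oO) (IH _ (d2f v)) => x Ox /=.
by rewrite (diff_comp (df x Ox) (dl _)) /= diff_lin.
Qed.

(** * Derivatives of differentials along curves *)

(** A product rule for ['d F x v], in which both [x] and [v] move. The hypothesis concerns a fixed
    [v] only, so [v] is expanded in the standard basis. *)
Lemma is_derive_diff_dir (R : realType) (n : nat) (F : 'rV[R]_n -> R)
    (y eta : R -> 'rV[R]_n) (s : R) (dy deta : 'rV[R]_n) :
  (forall v, differentiable (fun x => 'd F x v) (y s)) ->
  is_derive s 1 y dy -> is_derive s 1 eta deta ->
  is_derive s 1 (fun t => 'd F (y t) (eta t))
    ('d (fun x => 'd F x (eta s)) (y s) dy + 'd F (y s) deta).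
Proof.
move=> d2F dery dereta.
have dFsum x v : 'd F x v = \sum_(i < n) v 0 i * 'd F x (delta_mx 0 i).
  rewrite {1}[v]row_sum_delta linear_sum.
  by apply: eq_bigr => i _; rewrite linearZ.
pose D i := 'd (fun x => 'd F x (delta_mx 0 i)) (y s) dy.
have dyi i : is_derive s 1 (fun t => 'd F (y t) (delta_mx 0 i)) (D i).
  exact: (is_derive_comp_diff (f := fun x => 'd F x (delta_mx 0 i))).
have gen (e : R -> 'rV[R]_n) (de : 'rV[R]_n) : is_derive s 1 e de ->
    is_derive s 1 (fun t => 'd F (y t) (e t))
      (\sum_(i < n) e s 0 i * D i + 'd F (y s) de).
  move=> dere.
  have dei i := is_deriveM (is_derive_mx_coord 0 i dere) (dyi i).
  have E : (fun t => 'd F (y t) (e t)) = \sum_(i < n)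
      ((fun t => e t 0 i) * (fun t => 'd F (y t) (delta_mx 0 i))).
    apply/funext => t; rewrite fct_sumE; exact: dFsum.
  rewrite E; apply: (is_derive_eq (is_derive_sum dei)).
  have -> := dFsum (y s) de.
  rewrite big_split /=; congr (_ + _).
  by apply: eq_bigr => i _; rewrite [LHS]mulrC.
(* The rule [gen] for the constant direction [eta s] identifies the sum over the basis with the
   second differential. *)
have E : 'd (fun x => 'd F x (eta s)) (y s) dy = \sum_(i < n) eta s 0 i * D i.
  have h1 := is_derive_comp_diff (d2F (eta s)) dery.
  have h2 := gen (cst (eta s)) 0 (is_derive_cst _ _ _).
  apply: (is_derive_unique h1); apply: (is_derive_eq h2).
  have -> := linear0 ('d F (y s)).
  exact: addr0.
exact: (is_derive_eq (gen eta deta dereta)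
  (congr1 (fun a => a + 'd F (y s) deta) (esym E))).
Qed.

Lemma diff_diffC (R : realType) (V : normedModType R) (n : nat)
    (f : V -> 'rV[R]_n) (O : set V) (x u v : V) : open O -> O x -> Ck 2 O f ->
  'd (fun y => 'd f y u) x v = 'd (fun y => 'd f y v) x u.
Proof.
move=> oO Ox [df d2f]; apply/rowP => j.
have cf a b : {for x, continuous (fun y => ('d (fun z => 'd f z a) y b) 0 j)}.
  exact: (continuous_comp ((d2f a).2 b x Ox)
    (@coord_continuous R 1 n 0 j ('d (fun z => 'd f z a) x b))).
have d1 a y : O y -> is_derive y a (fun z => f z 0 j) ('d f y a 0 j).
  by move=> Oy; apply: is_derive_mx_coord; apply/is_derive_diff/df.
have d2 a b y : O y -> is_derive y b (fun z => 'd f z a 0 j)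
    ('d (fun z => 'd f z a) y b 0 j).
  move=> Oy; apply: is_derive_mx_coord; apply: is_derive_diff.
  exact: (d2f a).1 y Oy.
exact: (mixed_derivatives_eq oO Ox (d1 u) (d1 v) (d2 u v) (d2 v u)
  (cf u v) (cf v u)).
Qed.

(* Here y is the curve in bundle coordinates and z the curve (u(s), t(s)); its
   velocity is split into w = (u', 0) and the time direction e.  Then
   'd P (z s) w is v - xi, and 'd P (z s) e is xi. *)
Lemma moving_energy_derivative (R : realType) (n N : nat)
    (F : 'rV[R]_(n + n) -> R) (OF : set 'rV[R]_(n + n))
    (P : 'rV[R]_N -> 'rV[R]_n) (A : set 'rV[R]_N)
    (y : R -> 'rV[R]_(n + n)) (z : R -> 'rV[R]_N) (s : R)
    (dy : 'rV[R]_(n + n)) (w e : 'rV[R]_N) :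
  open OF -> Ck 2 OF F -> OF (y s) -> open A -> Ck 2 A P -> A (z s) ->
  is_derive s 1 y dy -> is_derive s 1 z (w + e) ->
  y s = row_mx (P (z s)) ('d P (z s) (w + e)) ->
  lsubmx dy = 'd P (z s) (w + e) ->
  'D_dy ('D_(ver ('d P (z s) w)) F) (y s) - 'D_(hor ('d P (z s) w)) F (y s)
    = 0 ->
  (\forall h \near (0 : R), F (row_mx (P (h *: e + z s))
       ('d P (h *: e + z s) (w + e))) = F (y s)) ->
  is_derive s 1
    (fun t => 'd F (y t) (ver (rsubmx (y t) - 'd P (z t) e)) - F (y t)) 0.
Proof.
move=> oOF [dF d2F] OFy oA CP Az dery derz ys lY lag cst_F.
have [dP d2P] := CP.
(* This is xi', the derivative of xi along the curve. *)
pose k := 'd (fun x => 'd P x e) (z s) (w + e).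
have dPe : is_derive s 1 (fun t => 'd P (z t) e) k.
  apply: (is_derive_comp_diff (f := fun x => 'd P x e)) derz.
  exact: (d2P e).1.
have deta : is_derive s 1 (fun t => ver (rsubmx (y t) - 'd P (z t) e))
    (ver (rsubmx dy - k)).
  exact: (is_derive_row_mx (is_derive_cst (0 : 'rV[R]_n) s 1)
    (is_deriveB (is_derive_rsubmx dery) dPe)).
have d2Fy v : differentiable (fun x => 'd F x v) (y s).
  exact: (d2F v).1.
have [DF DFE] : exists D : {linear 'rV[R]_(n + n) -> R}, 'd F (y s) = D.
  by exists ('d F (y s)).
have d1 := is_derive_diff_dir d2Fy dery deta.
have d2 := is_derive_comp_diff (dF _ OFy) dery.
have d3 := is_deriveB d1 d2.
apply: (is_derive_eq d3) => {d1 d2 d3}.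
have [DP DPE] : exists D : {linear 'rV[R]_N -> 'rV[R]_n}, 'd P (z s) = D.
  by exists ('d P (z s)).
have eta_s : rsubmx (y s) - 'd P (z s) e = 'd P (z s) w.
  by rewrite ys row_mxKr DPE linearD addrK.
have lag' : 'd (fun x => 'd F x (ver ('d P (z s) w))) (y s) dy =
    DF (hor ('d P (z s) w)).
  move/eqP : lag; rewrite subr_eq0 (deriveE _ (dF _ OFy)) DFE => /eqP <-.
  rewrite -(deriveE _ (d2Fy _)); apply: near_eq_derive.
  by apply: (near_eq_open oOF OFy) => x Ox; rewrite (deriveE _ (dF _ Ox)).
(* The vector (xi, xi') is the velocity at h = 0 of the lifted point when only time moves: by
   [diff_diffC], differentiating ['d P _ (w + e)] along [e] gives [k]. [F] is constant along that
   curve. *)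
have dcst : DF (row_mx ('d P (z s) e) k) = 0.
  have z0 : 0 *: e + z s = z s by rewrite scale0r add0r.
  have d1 := (is_derive_lineP _ _ _ _).1 (is_derive_diff e (dP _ Az)).
  have d2 := (is_derive_lineP _ _ _ _).1 (is_derive_eq
    (is_derive_diff e ((d2P (w + e)).1 _ Az)) (diff_diffC (w + e) e oA Az CP)).
  have d3 := is_derive_row_mx d1 d2.
  have h1 := is_derive_comp_diff (f := F) _ d3.
  rewrite z0 -ys DFE in h1; move: h1 => /(_ (dF _ OFy)) h1.
  have h2 := near_eq_is_derive cst_F h1.
  exact: is_derive_unique h2 (is_derive_cst _ _ _).
rewrite eta_s DFE; rewrite DPE in lag' dcst lY *.
(* The velocity of the curve is split so that [DF] kills the last summand; the other two are what
   the product rule and [lag'] produce for the derivative of the momentum term. *)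
have dyE : dy = hor (DP w) + ver (rsubmx dy - k) + row_mx (DP e) k.
  rewrite /hor /ver !add_row_mx addr0 add0r subrK -linearD -lY.
  by rewrite hsubmxK.
have DFdy : DF dy = DF (hor (DP w)) + DF (ver (rsubmx dy - k)).
  by rewrite {1}dyE !linearD dcst addr0.
have -> := congr1 (fun a => a + DF (ver (rsubmx dy - k)) - DF dy) lag'.
by rewrite DFdy subrr.
Qed.

(** * Charts, tangent vectors and curves *)

Lemma get_set1 (T : pointedType) (a : T) : get [set a] = a.
Proof. by have := getPex (ex_intro [set a] a erefl). Qed.

(** The part of [is_manifold] on which [repE] rests. It is established separately for the line,
    products and tangent bundles, so that no full manifold structure has to be built there. *)
Definition injective_charts (R : realType) (n : nat) (M : atlas R n) : Prop :=
  forall c q q', cdom M c q -> cdom M c q' ->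
    ccoord M c q = ccoord M c q' -> q = q'.

Lemma repE (R : realType) (n : nat) (M : atlas R n) (W : normedModType R)
    (c : chart M) (f : M -> W) (q : M) :
  injective_charts M -> cdom M c q -> rep c f (ccoord M c q) = f q.
Proof.
move=> inj cq; rewrite /rep -[RHS]get_set1; congr get.
apply/seteqP; split=> [_ [q' [cq' /= e] <-]|_ ->]; last by exists q.
by rewrite (inj _ _ _ cq' cq e).
Qed.

Lemma injective_prod (R : realType) (m n : nat) (M : atlas R m)
    (N : atlas R n) : injective_charts M -> injective_charts N ->
  injective_charts (prod_atlas M N).
Proof.
move=> iM iN [c d] [p q] [p' q'] [/= cp dq] [/= cp' dq'] /= /eq_row_mx[e1 e2].
by rewrite (iM _ _ _ cp cp' e1) (iN _ _ _ dq dq' e2).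
Qed.

Lemma injective_line (R : realType) : injective_charts (line R).
Proof.
move=> c s t _ _ /= /(congr1 (fun a : 'M[R]_1 => a 0 0)).
by rewrite !mxE !mulr1n.
Qed.

Lemma is_derive_scalar_mx (R : realType) (t : R) :
  is_derive t 1 (fun s : R => s%:M : 'rV[R]_1) 1%:M.
Proof.
have -> : (fun s : R => s%:M : 'rV[R]_1) = (fun s => s *: (1%:M : 'rV[R]_1)).
  by apply/funext => s; rewrite scalemx1.
exact: is_derive_scale.
Qed.

Lemma is_derive_continuous (R : realType) (V : normedModType R) (f : R -> V)
    (t : R) (l : V) : is_derive t 1 f l -> {for t, continuous f}.
Proof. by move=> [d _]; apply/differentiable_continuous/derivable1_diffP. Qed.

(** The first condition stands for continuity: coordinates are meaningless outside [cdom M c], so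
    their derivative says something only if the curve stays in it near [t]. *)
Definition derivable_curve (R : realType) (n : nat) (M : atlas R n)
    (g : R -> M) (t : R) : Prop :=
  forall c, cdom M c (g t) ->
    (\forall s \near t, cdom M c (g s)) /\ derivable (ccoord M c \o g) t 1.

Lemma smooth_curve_derivable (R : realType) (n : nat) (M : atlas R n)
    (J : set R) (g : R -> M) (t : R) :
  smooth_curve J g -> J t -> derivable_curve g t.
Proof.
move=> sg Jt c cgt; have [oA /(_ 1%N)[dA _]] := sg tt c.
set A := (X in open X) in oA dA.
have At : A t%:M by exists t.
have dt := is_derive_scalar_mx t.
have nA : \forall s \near t, A (s%:M : 'rV[R]_1).
  exact: (is_derive_continuous dt (open_nbhs_nbhs (conj oA At))).
split.
  apply: filterS nA => s [s' [[_ _] cs'] /= e].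
  by rewrite -(@injective_line R tt s' s I I e).
have := is_derive_comp_diff (f := rep (M := line R) tt (ccoord M c \o g))
  (dA _ At) dt.
have -> : rep (M := line R) tt (ccoord M c \o g) \o (fun s : R => s%:M) =
    ccoord M c \o g.
  apply/funext => s.
  exact: (repE (M := line R) (c := tt) _ (@injective_line R) I).
by case.
Qed.

Section Charts.
Variables (R : realType) (n : nat) (Q : atlas R n).
Hypothesis mQ : is_manifold Q.

Lemma manifold_injective : injective_charts Q.
Proof. by case: mQ. Qed.

Lemma chart_at_dom q : cdom Q (chart_at Q q) q.
Proof. by case: mQ. Qed.

Lemma transition_open c d : open (ccoord Q c @` (cdom Q c `&` cdom Q d)).
Proof. by have [_ _ h _ _] := mQ; case: (h c d). Qed.

Lemma transition_diff c d q : cdom Q c q -> cdom Q d q ->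
  differentiable (rep c (ccoord Q d)) (ccoord Q c q).
Proof.
move=> cq dq; have [_ _ h _ _] := mQ; have [_ /(_ 1%N)[/= dd _]] := h c d.
by apply: dd; exists q.
Qed.

(** The two openness hypotheses ensure that near [p] the map [f] lands in both charts, where both
    representatives are meaningful. *)
Lemma rep_change (m : nat) (M : atlas R m) (f : M -> Q) a c d p :
  injective_charts M ->
  open (ccoord M a @` (cdom M a `&` f @^-1` cdom Q c)) ->
  open (ccoord M a @` (cdom M a `&` f @^-1` cdom Q d)) ->
  cdom M a p -> cdom Q c (f p) -> cdom Q d (f p) ->
  \forall x \near ccoord M a p,
    rep d (ccoord Q c) (rep a (ccoord Q d \o f) x) = rep a (ccoord Q c \o f) x.
Proof.
move=> iM oc od ap cfp dfp.
have nc := open_nbhs_nbhs (conj oc (ex_intro2 _ _ p (conj ap cfp) erefl)).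
have nd := open_nbhs_nbhs (conj od (ex_intro2 _ _ p (conj ap dfp) erefl)).
apply: filterS2 nc nd => x [p1 [ap1 cp1] <-] [p2 [ap2 dp2] e].
rewrite !(repE _ iM ap1) /=.
by rewrite (repE _ manifold_injective) // -(iM _ _ _ ap2 ap1 e).
Qed.

Lemma is_derive_change (m : nat) (M : atlas R m) (f : M -> Q) a c d p v l :
  injective_charts M ->
  open (ccoord M a @` (cdom M a `&` f @^-1` cdom Q c)) ->
  open (ccoord M a @` (cdom M a `&` f @^-1` cdom Q d)) ->
  cdom M a p -> cdom Q c (f p) -> cdom Q d (f p) ->
  is_derive (ccoord M a p) v (rep a (ccoord Q d \o f)) l ->
  is_derive (ccoord M a p) v (rep a (ccoord Q c \o f))
    ('d (rep d (ccoord Q c)) (ccoord Q d (f p)) l).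
Proof.
move=> iM oc od ap cfp dfp dl.
apply: near_eq_is_derive (rep_change iM oc od ap cfp dfp) _.
have E : ccoord Q d (f p) = rep a (ccoord Q d \o f) (ccoord M a p).
  by rewrite (repE _ iM ap).
rewrite E; apply: is_derive_comp_diff dl; rewrite -E.
exact: transition_diff.
Qed.

Lemma tcompE c q v : cdom Q c q ->
  tcomp c q v =
  'd (rep (chart_at Q q) (ccoord Q c)) (ccoord Q (chart_at Q q) q) v.
Proof.
move=> cq; apply: deriveE; apply: transition_diff => //; exact: chart_at_dom.
Qed.

Lemma is_derive_rep_id c q v : cdom Q c q ->
  is_derive (ccoord Q c q) v (rep c (ccoord Q c)) v.
Proof.
move=> cq; apply: near_eq_is_derive (is_derive_id _ _).
have : nbhs (ccoord Q c q) (ccoord Q c @` (cdom Q c `&` cdom Q c)).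
  by apply: open_nbhs_nbhs; split; [exact: transition_open|exists q].
by apply: filterS => _ [p [cp _] <-]; rewrite (repE _ manifold_injective).
Qed.

Lemma tcomp_chart_at q v : tcomp (chart_at Q q) q v = v.
Proof. by have [_] := is_derive_rep_id v (chart_at_dom q). Qed.

(** Passing to the chart [c] and back is the chain rule for the identity read in the preferred
    chart, whose derivative along [v] is [v]. *)
Lemma tcompK c q v : cdom Q c q ->
  'd (rep c (ccoord Q (chart_at Q q))) (ccoord Q c q) (tcomp c q v) = v.
Proof.
move=> cq; have cq' := chart_at_dom q.
apply: is_derive_unique (is_derive_rep_id v cq').
apply: (is_derive_change (f := idfun) manifold_injective) => //.
- exact: transition_open.
- exact: transition_open.
rewrite tcompE //; apply: is_derive_diff; exact: transition_diff.
Qed.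

Lemma tcompKr c q v : cdom Q c q ->
  tcomp c q ('d (rep c (ccoord Q (chart_at Q q))) (ccoord Q c q) v) = v.
Proof.
move=> cq; have cq' := chart_at_dom q.
rewrite tcompE //; apply: is_derive_unique (is_derive_rep_id v cq).
apply: (is_derive_change (f := idfun) manifold_injective) => //.
- exact: transition_open.
- exact: transition_open.
apply: is_derive_diff; exact: transition_diff.
Qed.

(** The velocity is defined in the chart preferred at [g t]; the chain rule with the transition map
    carries it to [c]. *)
Lemma is_derive_curve (g : R -> Q) (t : R) c :
  derivable_curve g t -> cdom Q c (g t) ->
  is_derive t 1 (ccoord Q c \o g) (tcomp c (g t) (velocity g t)).
Proof.
move=> dg cgt; have [nd der] := dg _ (chart_at_dom (g t)).
have [nc _] := dg _ cgt.
have V : velocity g t = 'D_1 (ccoord Q (chart_at Q (g t)) \o g) t.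
  exact: derive1E.
apply: (is_derive_eq _ (esym (tcompE (velocity g t) cgt))); rewrite V.
have := is_derive_comp_diff (g := ccoord Q (chart_at Q (g t)) \o g)
  (transition_diff (chart_at_dom (g t)) cgt) (derivableP der).
apply: near_eq_is_derive; apply: filterS2 nc nd => s cs ds /=.
by rewrite (repE _ manifold_injective).
Qed.

End Charts.

Lemma tcompD (R : realType) (n : nat) (M : atlas R n) c (q : M) v w :
  is_manifold M -> cdom M c q -> tcomp c q (v + w) = tcomp c q v + tcomp c q w.
Proof. by move=> mM cq; rewrite !(tcompE mM _ cq) linearD. Qed.

(** * The tangent bundle *)

Section TangentBundle.
Variables (R : realType) (n : nat) (Q : atlas R n).
Hypothesis mQ : is_manifold Q.

Lemma injective_TB : injective_charts (TB Q).
Proof.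
move=> c [q v] [q' v'] /= cq cq' /eq_row_mx[e e2].
have qq := manifold_injective mQ cq cq' e; rewrite -qq in e2 *.
by rewrite -(tcompK mQ v cq) e2 (tcompK mQ v' cq).
Qed.

(** The image is the chart image times the whole of R^n, every component vector being reached by
    [tcompKr]. *)
Lemma TB_open (c : chart Q) : open (ccoord (TB Q) c @` cdom (TB Q) c).
Proof.
have -> : ccoord (TB Q) c @` cdom (TB Q) c =
    lsubmx @^-1` (ccoord Q c @` (cdom Q c `&` cdom Q c)).
  apply/seteqP; split=> [_ [[q v] /= cq <-]|x [q [cq _] /= e]].
    by exists q; rewrite ?row_mxKl.
  exists (q, 'd (rep c (ccoord Q (chart_at Q q))) (ccoord Q c q) (rsubmx x)) =>
    //=.
  by rewrite (tcompKr mQ _ cq) e hsubmxK.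
apply: open_comp; last exact: transition_open.
by move=> x _; exact: continuous_lsubmx.
Qed.

(** [tcomp_chart_at] asks for [is_manifold], which is not established for [TB Q]; here the open
    image and the injectivity of bundle charts show that the self-transition is locally the
    identity. *)
Lemma tcomp_TB_chart_at (x : TB Q) Z : tcomp (chart_at (TB Q) x) x Z = Z.
Proof.
have cx : cdom (TB Q) (chart_at (TB Q) x) x := chart_at_dom mQ x.1.
set c := chart_at (TB Q) x in cx *.
have nx : nbhs (ccoord (TB Q) c x) (ccoord (TB Q) c @` cdom (TB Q) c).
  by apply: open_nbhs_nbhs; split; [exact: TB_open|exists x].
have [_] : is_derive (ccoord (TB Q) c x) Z (rep c (ccoord (TB Q) c)) Z => //.
apply: near_eq_is_derive (is_derive_id _ _).
by apply: filterS nx => _ [p cp <-]; rewrite (repE _ injective_TB cp).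
Qed.

Lemma derivable_curve_base (x : R -> TB Q) (t : R) :
  derivable_curve x t -> derivable_curve (fun s => (x s).1 : Q) t.
Proof.
move=> dx c cx; have [nx der] := dx c cx; split=> //.
have := is_derive_lsubmx (derivableP der).
have -> : (fun s => lsubmx ((ccoord (TB Q) c \o x) s)) =
    ccoord Q c \o (fun s => (x s).1).
  by apply/funext => s; rewrite /= row_mxKl.
by case.
Qed.

End TangentBundle.

(** * Time-dependent diffeomorphisms *)

Section Flow.
Variables (R : realType) (n : nat) (Q U : atlas R n) (Qt : U -> R -> Q).
Hypotheses (mQ : is_manifold Q) (mU : is_manifold U).
Hypothesis sC : smooth_map setT (time_dependent_map Qt).

Definition flow : times_line U -> Q := fun x => Qt x.1 x.2.

Definition flow_dom (cu : chart U) (c : chart Q) : set 'rV[R]_(n + 1) :=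
  ccoord (times_line U) (cu, tt) @`
    (cdom (times_line U) (cu, tt) `&` flow @^-1` cdom Q c).

(** The map P of the overview. Space and time form one vector, so T Q_t and the time derivative are
    the same differential, taken along [row_mx w 0] and [row_mx 0 1%:M]. *)
Definition flow_rep (cu : chart U) (c : chart Q) : 'rV[R]_(n + 1) -> 'rV[R]_n :=
  rep (M := times_line U) (cu, tt) (ccoord Q c \o flow).

Definition flow_pt (cu : chart U) (u : U) (t : R) : 'rV[R]_(n + 1) :=
  row_mx (ccoord U cu u) t%:M.

Lemma injective_times_line : injective_charts (times_line U).
Proof. exact: injective_prod (manifold_injective mU) (@injective_line R). Qed.

Lemma flow_repE cu c u t : cdom U cu u ->
  flow_rep cu c (flow_pt cu u t) = ccoord Q c (Qt u t).
Proof.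
move=> cuu.
exact: (repE (c := (cu, tt) : chart (times_line U)) (q := (u, t)) _
  injective_times_line (conj cuu I)).
Qed.

Lemma flow_dom_pt cu c u t : cdom U cu u -> cdom Q c (Qt u t) ->
  flow_dom cu c (flow_pt cu u t).
Proof. by move=> cuu cq; exists (u, t). Qed.

(** Smoothness is given for the map into Q x R; its Q part is extracted by the linear map
    [lsubmx]. *)
Lemma flow_open_Ck cu c : open (flow_dom cu c) /\
  forall k, Ck k (flow_dom cu c) (flow_rep cu c).
Proof.
have [] :=
  sC ((cu, tt) : chart (times_line U)) ((c, tt) : chart (times_line Q)).
set A := (X in open X) => oA CA.
have AE : A = flow_dom cu c.
  apply/seteqP; split=> y [x].
    by move=> [[xcu _] [xc _]] <-; exists x.
  by move=> [xcu xc] <-; exists x.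
rewrite -AE; split=> // k.
pose l : {linear 'rV[R]_(n + 1) -> 'rV[R]_n} := lsubmx.
apply: (Ck_eq oA) (Ck_linear (l := l) oA (@continuous_lsubmx R 1 n 1) (CA k)).
rewrite AE /flow_rep => _ [x [cx _] <-].
rewrite /= (repE (M := times_line U) _ injective_times_line cx).
rewrite (repE (M := times_line U) _ injective_times_line cx).
exact: row_mxKl.
Qed.

Lemma flow_diff cu c u t : cdom U cu u -> cdom Q c (Qt u t) ->
  differentiable (flow_rep cu c) (flow_pt cu u t).
Proof.
move=> cuu cq; have [_ /(_ 1%N)[df _]] := flow_open_Ck cu c.
exact/df/flow_dom_pt.
Qed.

Lemma flow_rep_change cu c u t v : cdom U cu u -> cdom Q c (Qt u t) ->
  tcomp c (Qt u t) ('d (flow_rep cu (chart_at Q (Qt u t))) (flow_pt cu u t) v) =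
  'd (flow_rep cu c) (flow_pt cu u t) v.
Proof.
move=> cuu cq; have dq := chart_at_dom mQ (Qt u t).
rewrite (tcompE mQ _ cq).
apply: (@is_derive_unique _ _ _ (flow_rep cu c) (flow_pt cu u t) v); last first.
  by apply: is_derive_diff; exact: flow_diff.
apply: (is_derive_change mQ (M := times_line U) (a := (cu, tt)) (p := (u, t))
  injective_times_line (flow_open_Ck cu c).1
  (flow_open_Ck cu (chart_at Q (Qt u t))).1) => //.
by apply: is_derive_diff; exact: flow_diff.
Qed.

(** The source chart is arbitrary because the direction has no component along U. In [flow_tmap] it
    has to be [chart_at U u], the chart in which [w] is represented. *)
Lemma flow_velocity cu c u t : cdom U cu u -> cdom Q c (Qt u t) ->
  tcomp c (Qt u t) (velocity (Qt u) t) =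
  'd (flow_rep cu c) (flow_pt cu u t) (row_mx 0 1%:M).
Proof.
move=> cuu cq; rewrite -(flow_rep_change _ cuu cq); congr tcomp.
rewrite /velocity derive1E.
set d := chart_at Q (Qt u t).
have dd := flow_diff cuu (chart_at_dom mQ (Qt u t)).
have dp : is_derive t 1 (flow_pt cu u) (row_mx 0 1%:M).
  exact: is_derive_row_mx (is_derive_cst _ _ _) (is_derive_scalar_mx t).
have [_] := is_derive_comp_diff dd dp; rewrite -/d => <-.
by congr ('D_1 _ t); apply/funext => s; rewrite /= flow_repE.
Qed.

Lemma flow_tmap c u w t : cdom Q c (Qt u t) ->
  tcomp c (Qt u t) (tmap (Qt^~ t) u w) =
  'd (flow_rep (chart_at U u) c) (flow_pt (chart_at U u) u t) (row_mx w 0).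
Proof.
move=> cq; have uu := chart_at_dom mU u.
rewrite -(flow_rep_change _ uu cq); congr tcomp.
set cu := chart_at U u in uu *; set d := chart_at Q (Qt u t).
have dd := flow_diff uu (chart_at_dom mQ (Qt u t)).
have dp : is_derive (ccoord U cu u) w (fun x : 'rV[R]_n => row_mx x t%:M)
    (row_mx w 0).
  exact: is_derive_row_mx (is_derive_id _ _) (is_derive_cst _ _ _).
have [_] := is_derive_comp_diff (g := fun x : 'rV[R]_n => row_mx x t%:M) dd dp.
rewrite -/d => <-.
rewrite /tmap -/cu -/d; apply: near_eq_derive.
have : nbhs (ccoord U cu u) (ccoord U cu @` (cdom U cu `&` cdom U cu)).
  by apply: open_nbhs_nbhs; split; [exact: transition_open|exists u].
apply: filterS => _ [p [cp _] <-].
rewrite (repE _ (manifold_injective mU) cp) /=.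
by rewrite -[row_mx _ _]/(flow_pt cu p t) flow_repE.
Qed.

Lemma flow_lift c u w t : cdom Q c (Qt u t) ->
  tcomp c (Qt u t) (tmap (Qt^~ t) u w + velocity (Qt u) t) =
  'd (flow_rep (chart_at U u) c) (flow_pt (chart_at U u) u t) (row_mx w 1%:M).
Proof.
move=> cq; rewrite (tcompD _ _ mQ cq) (flow_tmap _ cq).
rewrite (flow_velocity (chart_at_dom mU u) cq) -linearD.
by rewrite add_row_mx addr0 add0r.
Qed.

(* The energy at DC((u, w), t) depends on w only through T Q_t(w), so that
   injectivity of T Q_t is not needed in moving_energyE. *)
Lemma energy_liftE (L : TB Q -> R) c u w t : smooth_fun L ->
  cdom Q c (Qt u t) ->
  let y := ccoord (TB Q) c (Qt u t, tmap (Qt^~ t) u w + velocity (Qt u) t) in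
  energy (autonomous L \o lift_tdep Qt) ((u, w), t) =
    'd (rep (M := TB Q) c L) y (ver (tcomp c (Qt u t) (tmap (Qt^~ t) u w)))
    - rep (M := TB Q) c L y.
Proof.
move=> sL cq y; rewrite /energy /autonomous /=.
set x := (Qt u t, _).
have cx : cdom (TB Q) c x by [].
rewrite (repE _ (injective_TB mQ) cx); congr (_ - _).
have dL : differentiable (rep (M := TB Q) c L) y.
  by have [dL _] := sL c 1%N; apply: dL; exists x.
set z := flow_pt (chart_at U u) u t.
set P := flow_rep (chart_at U u) c.
pose k w' : 'rV[R]_(n + n) :=
  row_mx (ccoord Q c (Qt u t)) ('d P z (row_mx w' 1%:M)).
have dPz : continuous ('d P z).
  by apply: diff_continuous; exact: (flow_diff (chart_at_dom mU u) cq).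
have dk : is_derive w w k (ver (tcomp c (Qt u t) (tmap (Qt^~ t) u w))).
  rewrite (flow_tmap _ cq).
  apply: is_derive_row_mx (is_derive_cst _ _ _) _.
  apply: (is_derive_linear (f := 'd P z)) dPz _.
  exact: is_derive_row_mx (is_derive_id _ _) (is_derive_cst _ _ _).
have yk : y = k w by rewrite /y /k /= (flow_lift _ cq).
rewrite yk in dL *.
have [_ <-] := is_derive_comp_diff dL dk.
congr ('D_w _ w); apply/funext => w'.
rewrite /= /k -(flow_lift _ cq).
exact: esym (repE (M := TB Q) (c := c)
  (q := (Qt u t, tmap (Qt^~ t) u w' + velocity (Qt u) t)) L
  (injective_TB mQ) cq).
Qed.

End Flow.

(** * The moving energy along a curve *)

Lemma derivable_curve_fst (R : realType) (n : nat) (M : atlas R n)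
    (g : R -> times_line M) (t : R) :
  derivable_curve g t -> derivable_curve (fun s => (g s).1) t.
Proof.
move=> dg c cg.
have [ng der] := dg ((c, tt) : chart (times_line M)) (conj cg I).
split; first by apply: filterS ng => s [].
have := is_derive_lsubmx (derivableP der).
have -> : (fun s => lsubmx ((ccoord (times_line M) (c, tt) \o g) s)) =
    ccoord M c \o (fun s => (g s).1).
  by apply/funext => s; exact: row_mxKl.
by case.
Qed.

Lemma derivable_curve_pair (R : realType) (n : nat) (M : atlas R n)
    (q : R -> M) (f : R -> R) (t l : R) :
  derivable_curve q t -> is_derive t 1 (fun s => (f s)%:M : 'rV[R]_1) l%:M ->
  derivable_curve (fun s => (q s, f s) : times_line M) t.
Proof.
move=> dq df [c []] [/= cq _]; have [nq der] := dq c cq.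
split; first by apply: filterS nq.
by have [] := is_derive_row_mx (derivableP der) df.
Qed.

Lemma derivable_curve_comp (R : realType) (m n : nat) (M : atlas R m)
    (N : atlas R n) (G : M -> N) (g : R -> M) (t : R) a :
  injective_charts M -> smooth_map setT G -> cdom M a (g t) ->
  derivable_curve g t -> derivable_curve (G \o g) t.
Proof.
move=> iM sG ag dg c cGg; have [ng der] := dg a ag.
have [oA /(_ 1%N)[dA _]] := sG a c.
set A := (X in open X) in oA dA.
have At : A (ccoord M a (g t)) by exists (g t).
have der' := derivableP der.
have nA : \forall s \near t, A (ccoord M a (g s)).
  exact: (is_derive_continuous der' (open_nbhs_nbhs (conj oA At))).
split.
  apply: filterS2 ng nA => s ags [p [[ap _] cp] e] /=.
  by rewrite -(iM _ _ _ ap ags e).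
have := is_derive_comp_diff (g := ccoord M a \o g) (dA _ At) der'.
move=> [d _]; apply: near_eq_derivable d; apply: filterS ng => s ags.
by rewrite /= (repE _ iM ags).
Qed.

Section MovingEnergy.
Variables (R : realType) (n : nat) (Q U : atlas R n) (Qt : U -> R -> Q).
Variable (L : TB Q -> R).
Hypotheses (mQ : is_manifold Q) (mU : is_manifold U) (sL : smooth_fun L).
Hypothesis sC : smooth_map setT (time_dependent_map Qt).
Hypothesis iC : injective (time_dependent_map Qt).

(** Every preimage under the lift gives [get] the same value: injectivity of C fixes u and t,
    cancelling the velocity term fixes T Q_t(w), and by [energy_liftE] the energy depends on nothing
    else. *)
Lemma moving_energyE u w t :
  moving_energy Qt L (lift_tdep Qt ((u, w), t)) =
  energy (autonomous L \o lift_tdep Qt) ((u, w), t).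
Proof.
rewrite /moving_energy -[RHS]get_set1; congr get.
apply/seteqP; split=> [_ [[[u' w'] t'] e <-]|_ ->]; last by exists ((u, w), t).
have tt' : t' = t by have := congr1 snd e.
rewrite tt' in e *.
have qq : Qt u' t = Qt u t by have := congr1 (fun x => x.1.1) e.
have uu : u' = u.
  have : (u', t) = (u, t) :> times_line U.
    by apply: iC; rewrite /time_dependent_map /= qq.
  by move=> /(congr1 fst).
rewrite uu in e *.
have /addIr ww : tmap (Qt^~ t) u w' + velocity (Qt u) t =
  tmap (Qt^~ t) u w + velocity (Qt u) t by have := congr1 (fun x => x.1.2) e.
have cq := chart_at_dom mQ (Qt u t).
by rewrite !(energy_liftE mQ mU sC _ sL cq) ww.
Qed.

Variables (g : R -> times_line (TB Q)) (u : R -> U).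
Let q s : Q := (g s).1.1.
Let v s : 'rV[R]_n := (g s).1.2.
Let t s : R := (g s).2.
Let w s : 'rV[R]_n := velocity u s.

Hypothesis Qu : forall s, Qt (u s) (t s) = q s.

(** Time runs at unit rate, [Z] is the velocity of the TQ part in the preferred bundle chart, and
    [lsubmx Z = v s] is the second-order condition q' = v. *)
Definition second_order_curve (s : R) (Z : 'rV[R]_(n + n)) : Prop :=
  [/\ derivable_curve (fun s => (g s).1) s,
      is_derive s 1 (fun s => (t s)%:M : 'rV[R]_1) 1%:M,
      is_derive s 1 (ccoord (TB Q) (chart_at Q (q s)) \o (fun s => (g s).1)) Z
    & lsubmx Z = v s] /\ derivable_curve u s.

Lemma is_derive_flow_pt cu s Z : second_order_curve s Z -> cdom U cu (u s) ->
  is_derive s 1 (fun s => flow_pt cu (u s) (t s))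
    (row_mx (tcomp cu (u s) (w s)) 1%:M).
Proof.
move=> [[_ dt _ _] du] cuu.
exact: is_derive_row_mx (is_derive_curve mU du cuu) dt.
Qed.

Lemma velocity_base s Z : second_order_curve s Z -> velocity q s = v s.
Proof.
move=> [[_ _ dy <-] _].
rewrite /velocity derive1E.
have [_ <-] := is_derive_lsubmx dy.
by congr ('D_1 _ s); apply/funext => s'; rewrite /= row_mxKl.
Qed.

(** The relation [Qu] is differentiated in [s], which gives v = T Q_t(u') + xi as a single
    differential. *)
Lemma tcomp_velocity cu c s Z : second_order_curve s Z -> cdom U cu (u s) ->
  cdom Q c (q s) ->
  tcomp c (q s) (v s) =
  'd (flow_rep Qt cu c) (flow_pt cu (u s) (t s))
    (row_mx (tcomp cu (u s) (w s)) 1%:M).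
Proof.
move=> H cuu cq; have [[dx _ _ _] du] := H.
rewrite -(velocity_base H).
apply: is_derive_unique (is_derive_curve mQ (derivable_curve_base dx) cq) _.
have dz := is_derive_flow_pt H cuu.
have dP : differentiable (flow_rep Qt cu c) (flow_pt cu (u s) (t s)).
  by apply: (flow_diff mU sC) => //; rewrite Qu.
have := is_derive_comp_diff (g := fun s => flow_pt cu (u s) (t s)) dP dz.
apply: near_eq_is_derive; have [nu _] := du _ cuu.
by apply: filterS nu => s' cu'; rewrite /= (flow_repE Qt mU _ _ cu') Qu.
Qed.

Lemma curve_lift s Z : second_order_curve s Z ->
  g s = lift_tdep Qt ((u s, w s), t s).
Proof.
move=> H; have uu := chart_at_dom mU (u s); have cq := chart_at_dom mQ (q s).
have := tcomp_velocity H uu cq; rewrite (tcomp_chart_at mQ) (tcomp_chart_at mU).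
have := @flow_lift _ _ _ _ _ mQ mU sC (chart_at Q (q s)) (u s) (w s) (t s).
rewrite Qu => /(_ cq) <-; rewrite (tcomp_chart_at mQ) => vs.
by rewrite /lift_tdep Qu -vs /q /v /t; case: (g s) => -[].
Qed.

(** This is <p, v - xi> - L in charts [cu] and [c] that need not be the preferred ones at [s]. Fixed
    charts can thus serve for all nearby times, as differentiating in [s] requires. *)
Lemma moving_energy_curve cu c s Z :
  second_order_curve s Z -> cdom U cu (u s) -> cdom Q c (q s) ->
  let y := ccoord (TB Q) c (g s).1 in
  moving_energy Qt L (g s) =
  'd (rep (M := TB Q) c L) y (ver (rsubmx y -
     'd (flow_rep Qt cu c) (flow_pt cu (u s) (t s)) (row_mx 0 1%:M)))
  - rep (M := TB Q) c L y.
Proof.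
move=> H cuu cq y.
have gs := curve_lift H.
have cq' : cdom Q c (Qt (u s) (t s)) by rewrite Qu.
rewrite {1}gs moving_energyE (energy_liftE mQ mU sC _ sL cq').
have -> : ccoord (TB Q) c (Qt (u s) (t s),
   tmap (Qt^~ (t s)) (u s) (w s) + velocity (Qt (u s)) (t s)) = y.
  by rewrite /y gs.
rewrite -(flow_velocity mQ mU sC cuu cq').
rewrite /y gs /= row_mxKr (tcompD _ _ mQ cq').
by rewrite addrK.
Qed.

End MovingEnergy.

(** * Integral curves of the nonholonomic field and conservation of the moving energy *)

Lemma integral_curve_derive (R : realType) (n : nat) (Q : atlas R n)
    (L : TB Q -> R) (D0 : Q -> set 'rV[R]_n) (rho : TB Q -> {scalar 'rV[R]_n})
    (X : TB Q -> 'rV[R]_(n + n)) (M0 : set (TB Q)) (J : set R)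
    (g : R -> times_line (TB Q)) (s : R) :
  is_manifold Q -> nonholonomic_field L M0 D0 rho X ->
  integral_curve (time_extended M0) (add_dt X) J g -> J s ->
  [/\ derivable_curve (fun s => (g s).1) s,
      is_derive s 1 (fun s => (g s).2%:M : 'rV[R]_1) 1%:M,
      is_derive s 1 (ccoord (TB Q) (chart_at Q (g s).1.1) \o (fun s => (g s).1))
        (X (g s).1)
    & lsubmx (X (g s).1) = (g s).1.2].
Proof.
move=> mQ [_ hX] [sg hg] Js.
have dg := smooth_curve_derivable sg Js.
have [Ms vg] := hg s Js.
have [_ _ lag] := hX _ Ms.
have cx : cdom Q (chart_at Q (g s).1.1) (g s).1.1 := chart_at_dom mQ _.
have [_ der] :=
  dg ((chart_at Q (g s).1.1, tt) : chart (times_line (TB Q))) (conj cx I).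
have dG := derivableP der.
have vE : 'D_1 (ccoord (times_line (TB Q)) (chart_at Q (g s).1.1, tt) \o g) s =
    row_mx (X (g s).1) 1%:M by rewrite -derive1E; exact: vg.
rewrite vE in dG.
split.
- exact: derivable_curve_fst.
- have := is_derive_rsubmx dG; rewrite row_mxKr.
  apply: near_eq_is_derive; near=> s'; exact: row_mxKr.
- have := is_derive_lsubmx dG; rewrite row_mxKl.
  apply: near_eq_is_derive; near=> s'; exact: row_mxKl.
(* The kinematic half of [lagrange_at], read in the preferred chart, is q' = v. *)
- have [] := lag _ cx.
  by rewrite (tcomp_TB_chart_at mQ (g s).1) (tcomp_chart_at mQ).
Unshelve. all: by end_near. Qed.

Theorem theorem1 (R : realType) (n r : nat) (Q U : atlas R n)
  (L : TB Q -> R) (D0 : Q -> set 'rV[R]_n) (xi0 : Q -> 'rV[R]_n)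
  (rho : TB Q -> {scalar 'rV[R]_n}) (X : TB Q -> 'rV[R]_(n + n))
  (M0 : set (TB Q)) (Qt : U -> R -> Q)
  (Q_manifold : is_manifold Q) (U_manifold : is_manifold U)
  (L_smooth : smooth_fun L) (L_regular : regular_lagrangian L)
  (r_range : (1 < r < n)%N) (D0_distribution : is_distribution r D0)
  (D0_nonintegrable : ~ integrable_distribution r D0)
  (xi0_smooth : smooth_vector_field xi0)
  (xi0_complete : complete_vector_field setT xi0)
  (M0_def : M0 = affine_subbundle xi0 D0)
  (X_nonholonomic : nonholonomic_field L M0 D0 rho X)
  (rho_unique : forall rho' X', nonholonomic_field L M0 D0 rho' X' ->
     forall x, M0 x -> rho' x =1 rho x)
  (X_complete : complete_vector_field M0 X)
  (C_diffeo : diffeomorphism (time_dependent_map Qt))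
  (hi : time_independent setT (autonomous L \o lift_tdep Qt))
  (hii : time_independent setT (moving_energy Qt L))
  (hiii : exists Mt : set (TB U), is_linear_subbundle Mt /\
     lift_tdep Qt @^-1` time_extended M0 = time_extended Mt) :
  time_independent M0 (moving_energy Qt L) /\
  first_integral (time_extended M0) (add_dt X) (moving_energy Qt L).
Proof.
split=> [x s t _|J g oJ iJ Hg]; first exact: hii.
have mQ := Q_manifold; have mU := U_manifold; have sL := L_smooth.
have [G [FK GK sC sG]] := C_diffeo.
have iC := can_inj FK.
apply: (derive0_cst (f := moving_energy Qt L \o g) oJ iJ) => s Js.
pose qt s : times_line Q := ((g s).1.1, (g s).2).
(* [G] inverts C, which preserves time, so [u s] is the preimage of q(s) under Q_t(s). *)
pose u s : U := (G (qt s)).1.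
have Gt s' : (G (qt s')).2 = (g s').2 by have := congr1 snd (GK (qt s')).
have Qu s' : Qt (u s') (g s').2 = (g s').1.1.
  by rewrite -Gt; have := congr1 fst (GK (qt s')).
have Hc s' : J s' -> second_order_curve g u s' (X (g s').1).
  move=> Js'; have H := integral_curve_derive mQ X_nonholonomic Hg Js'.
  split=> //; have [dx dt _ _] := H.
  apply: (derivable_curve_fst (g := G \o qt)).
  pose a : chart (times_line Q) := (chart_at Q (g s').1.1, tt).
  apply: (derivable_curve_comp (a := a)) => //.
  - exact: injective_prod (manifold_injective mQ) (@injective_line R).
  - by split=> //; exact: chart_at_dom.
  - exact: (derivable_curve_pair (derivable_curve_base dx) dt).
have H := Hc s Js; have [[dx dt dy lX] du] := H.
have [Ms _] := Hg.2 s Js.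
set q := (g s).1.1 in dy.
(* The charts [c] and [cu] are chosen at the time [s] and kept fixed from here on. *)
set c := chart_at Q q in dy.
have cq : cdom Q c q := chart_at_dom mQ q.
set cu := chart_at U (u s).
have cuu : cdom U cu (u s) := chart_at_dom mU (u s).
have cqt : cdom Q c (Qt (u s) (g s).2) by rewrite Qu.
set w := row_mx (velocity u s) 0 : 'rV[R]_(n + 1).
set e := row_mx 0 1%:M : 'rV[R]_(n + 1).
have weE : w + e = row_mx (velocity u s) 1%:M by rewrite add_row_mx addr0 add0r.
set P := flow_rep Qt cu c.
pose z s := flow_pt cu (u s) (g s).2.
pose y s := ccoord (TB Q) c (g s).1.
have tz := tcomp_velocity mQ mU sC Qu H cuu cq.
rewrite (tcomp_chart_at mU) -weE in tz.
have gs := curve_lift mQ mU sC Qu H.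
have tmapE : tmap (Qt^~ (g s).2) (u s) (velocity u s) = 'd P (z s) w.
  rewrite -(flow_tmap mQ mU sC _ cqt) Qu.
  by rewrite (tcomp_chart_at mQ).
have vE : (g s).1.2 = 'd P (z s) w + velocity (Qt (u s)) (g s).2.
  by rewrite {1}gs /= tmapE.
have D0w : D0 q ('d P (z s) w).
  have [Mt [[k [D [hD MtE]]] liftE]] := hiii.
  have Mt0 : time_extended Mt ((u s, 0), (g s).2).
    rewrite /time_extended /= MtE /total_space /=.
    have [V [B [_ Ou _ /(_ _ Ou)[_ ->]]]] := hD (u s).
    exact: sub0mx.
  rewrite -liftE in Mt0.
  have t0 : tmap (Qt^~ (g s).2) (u s) 0 = 0 by exact: derive0.
  have Mxi : M0 (Qt (u s) (g s).2, velocity (Qt (u s)) (g s).2).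
    by move: Mt0; rewrite /time_extended /preimage /= t0 add0r.
  have Mv : M0 (q, (g s).1.2).
    by move: Ms; rewrite /time_extended /= /q; case: (g s).1.
  rewrite Qu M0_def /affine_subbundle /= in Mxi.
  rewrite M0_def /affine_subbundle /= in Mv.
  have [V [B [_ Oq _ /(_ _ Oq)[_ D0E]]]] := D0_distribution q.
  rewrite D0E /= in Mxi Mv *.
  (* Both v and xi lie in the affine fiber, so [xi0] cancels in their difference. *)
  have -> : 'd P (z s) w =
      ((g s).1.2 - xi0 q) - (velocity (Qt (u s)) (g s).2 - xi0 q).
    by rewrite opprB addrA subrK vE addrK.
  by rewrite addmx_sub // eqmx_opp.
have lag :
    'D_(X (g s).1) ('D_(ver ('d P (z s) w)) (rep (M := TB Q) c L)) (y s) -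
    'D_(hor ('d P (z s) w)) (rep (M := TB Q) c L) (y s) = 0.
  have [_ rho0 lagr] := X_nonholonomic.2 _ Ms.
  have [_ /(_ ('d P (z s) w))] := lagr c cq.
  rewrite (tcomp_TB_chart_at mQ (g s).1) (tcomp_chart_at mQ) => ->.
  exact: rho0.
have cst_L : \forall h \near (0 : R), rep (M := TB Q) c L
    (row_mx (P (h *: e + z s)) ('d P (h *: e + z s) (w + e))) =
    rep (M := TB Q) c L (y s).
  have [oA _] := flow_open_Ck mU sC cu c.
  (* For small [h] the flow stays in the chart [c], where its representative is meaningful. *)
  have nA : \forall h \near (0 : R), flow_dom Qt cu c (h *: e + z s).
    apply: (is_derive_continuous (is_derive_line (z s) e 0)).
    rewrite /= scale0r add0r; apply: open_nbhs_nbhs; split => //.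
    exact: flow_dom_pt.
  apply: filterS nA => h [[u' t'] [[/= cu' _] cq'] /esym zE].
  have zE' : h *: e + z s = flow_pt cu (u s) (h + (g s).2).
    rewrite /e /z /flow_pt scale_row_mx scaler0 scalemx1 add_row_mx add0r.
    by rewrite raddfD.
  rewrite zE' in zE *.
  (* The point of U x R behind these coordinates, so far only known to exist, is [u s] at time
     [h + (g s).2]. *)
  have [/(manifold_injective mU cuu cu') uE tE] := eq_row_mx zE.
  have tE' := @injective_line R tt _ _ I I tE.
  rewrite /flow /= -uE -tE' in cq'.
  rewrite /P (flow_repE Qt mU _ _ cuu) weE -(flow_lift mQ mU sC _ cq').
  pose x := (lift_tdep Qt ((u s, velocity u s), h + (g s).2)).1.
  transitivity (rep (M := TB Q) c L (ccoord (TB Q) c x)); first by [].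
  rewrite /y !(repE (M := TB Q) _ (injective_TB mQ)) //.
  rewrite [in RHS]gs.
  exact: (hi (u s, velocity u s) (h + (g s).2) (g s).2 I).
have yz : y s = row_mx (P (z s)) ('d P (z s) (w + e)).
  by rewrite -tz /y /= /P (flow_repE Qt mU _ _ cuu) Qu.
have dz : is_derive s 1 z (w + e).
  by have := is_derive_flow_pt mU H cuu; rewrite (tcomp_chart_at mU) weE.
have lX' : lsubmx (X (g s).1) = 'd P (z s) (w + e).
  by rewrite lX -tz (tcomp_chart_at mQ).
have OFy : (ccoord (TB Q) c @` cdom (TB Q) c) (y s) by exists (g s).1.
have := moving_energy_derivative (@TB_open _ _ _ mQ c) (sL c 2%N) OFy
  (flow_open_Ck mU sC cu c).1 ((flow_open_Ck mU sC cu c).2 2%N)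
  (flow_dom_pt cuu cqt) dy dz yz lX' lag cst_L.
(* The formula in charts agrees with the moving energy at times in [J] for which the curve lies in
   [c] and its preimage in [cu], hence near [s]. *)
apply: near_eq_is_derive.
have [nc _] := derivable_curve_base dx cq.
have [nu _] := du cu cuu.
have nJ := open_nbhs_nbhs (conj oJ Js).
apply: filterS3 nJ nc nu => s' Js' cq' cu' /=.
by rewrite (moving_energy_curve mQ mU sL sC iC Qu (Hc s' Js') cu' cq').
Qed.
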